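(* Let $\mathcal{U}(x,t)=\sum_{m=0}^{\infty}\mathcal{U}_m(x,t)$ be the series solution, obtained by the $q$-homotopy analysis transform method ($q$-HATM), of the fractional differential equation $D_t^\alpha\,\mathcal{U}+R\,\mathcal{U}+N\,\mathcal{U}=f$, and let $\|\cdot\|$ denote the norm of the Banach space of continuous functions (maximum norm) in which the components $\mathcal{U}_m$ lie. Suppose there is a real number $0<\rho<1$ such that $$\|\mathcal{U}_{m+1}(x,t)\|\le\rho\,\|\mathcal{U}_m(x,t)\|\qquad\text{for all } m .$$ If the truncated series $\sum_{m=0}^{i}\mathcal{U}_m(x,t)$ is used as an approximation of the solution $\mathcal{U}(x,t)$, then the maximum absolute truncation error satisfies $$\Big\|\mathcal{U}(x,t)-\sum_{m=0}^{i}\mathcal{U}_m(x,t)\Big\|\le\frac{\rho^{\,i+1}}{1-\rho}\,\|\mathcal{U}_0(x,t)\| .$$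
   Context: In the equation, $D_t^\alpha$ is the Caputo fractional derivative in $t$ of order $r-1<\alpha\le r$ ($r\in\mathbb{N}$), $R$ is a bounded linear differential operator, $N$ is a Lipschitz continuous nonlinear differential operator, and $f(x,t)$ is a source term; initial data $\mathcal{U}^{(k)}(x,0)$, $0\le k\le r-1$, are prescribed. $q$-HATM: let $L$ be the Laplace transform in $t$ (with variable $s$), $\hbar\ne0$ and $n$ auxiliary parameters (embedding parameter $q\in[0,1/n]$), and $\mathcal{U}_0$ an initial guess. For $m\ge1$, $$\mathcal{U}_m=(k_m+\hbar)\,\mathcal{U}_{m-1}-\hbar\Big(1-\frac{k_m}{n}\Big)L^{-1}\Big[\frac{1}{s^\alpha}\sum_{k=0}^{r-1}s^{\alpha-k-1}\mathcal{U}^{(k)}(x,0)+\frac1{s^\alpha}L[f]\Big]+\hbar L^{-1}\Big[\frac1{s^\alpha}L[R\,\mathcal{U}_{m-1}+\mathcal{H}_{m-1}]\Big],$$ where $k_m=0$ for $m\le1$, $k_m=n$ for $m>1$, and $\mathcal{H}_m=\frac1{m!}\frac{\partial^m}{\partial q^m}N\big[\sum_{j\ge0}q^j\mathcal{U}_j\big]\big|_{q=0}$. The $q$-HATM series solution is $\mathcal{U}(x,t)=\sum_{m=0}^\infty\mathcal{U}_m(x,t)$. *)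

(* Defs.v *)
(* MathComp-Analysis, over an arbitrary realType. *)
From HB Require Import structures.
From mathcomp Require Import all_boot all_order all_algebra.
From mathcomp Require Import all_classical all_reals all_analysis.

Set Implicit Arguments.
Unset Strict Implicit.
Unset Printing Implicit Defensive.

Import Order.TTheory GRing.Theory Num.Theory.
Import numFieldNormedType.Exports.

Local Open Scope classical_set_scope.
Local Open Scope ring_scope.

Section SpaceTime.
Variables (R : realType) (d : nat).

(* A point is z = (x, t) with x in R^d.  Fields are total functions of z; only
   their values on (closure of the spatial domain) x [0, +oo[ ever matter. *)
Definition spacetime : Type := ('rV[R]_d * R)%type.
Definition field : Type := spacetime -> R.

(* Some j : the direction of x_j;  None : the direction of t. *)
Definition direction (i : option 'I_d) : spacetime :=
  if i is Some j then (delta_mx 0 j, 0) else (0, 1).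

Fixpoint partial (w : seq (option 'I_d)) (u : field) : field :=
  if w is i :: w' then fun z => 'D_(direction i) (partial w' u) z else u.

(* 'D is a junk value where the derivative does not exist; this says that the
   iterated derivative [partial w u] genuinely exists at z. *)
Fixpoint has_partial (w : seq (option 'I_d)) (u : field) (z : spacetime)
    : Prop :=
  if w is i :: w' then
    (\forall y \near z, has_partial w' u y) /\
    derivable (partial w' u) z (direction i)
  else True.

(* (A u)(z) = sum_w a_w(z) d^w u(z), over a finite list of derivatives. *)
Record linear_diffop := LinearDiffop {
  lin_derivs : seq (seq (option 'I_d));
  lin_coef : seq (option 'I_d) -> field
}.

Definition lin_apply (A : linear_diffop) (u : field) : field :=
  fun z => \sum_(w <- lin_derivs A) lin_coef A w z * partial w u z.

Definition lin_defined (A : linear_diffop) (u : field) (z : spacetime) : Prop :=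
  forall w, w \in lin_derivs A -> has_partial w u z.

(* (N u)(z) = F(z, d^{w_1} u(z), ..., d^{w_k} u(z)). *)
Record nonlinear_diffop := NonlinearDiffop {
  nl_derivs : seq (seq (option 'I_d));
  nl_fun : spacetime -> seq R -> R
}.

Definition nl_apply (N : nonlinear_diffop) (u : field) : field :=
  fun z => nl_fun N z [seq partial w u z | w <- nl_derivs N].

Definition nl_defined (N : nonlinear_diffop) (u : field) (z : spacetime)
    : Prop :=
  forall w, w \in nl_derivs N -> has_partial w u z.

(* The maximum norm of C(D) for compact D, and more generally the norm of the
   bounded continuous functions on D. *)
Definition maxnorm (D : set spacetime) (u : field) : R :=
  sup [set `|u z| | z in D].

End SpaceTime.

Section Laplace.
Variable R : realType.
Implicit Types (g F : R -> R) (s : R).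
Local Notation mu := (@lebesgue_measure R).

Definition laplace g s : R :=
  \int[mu]_(t in `[0, +oo[) (expR (- (s * t)) * g t).

Definition laplace_transformable g : Prop :=
  \forall s \near +oo,
    mu.-integrable `[0, +oo[ (fun t => (expR (- (s * t)) * g t)%:E).

(* g = L^{-1}[F].  By Lerch's theorem this determines g on ]0, +oo[. *)
Definition inverse_laplace F g : Prop :=
  [/\ {in `]0, +oo[, continuous g},
      laplace_transformable g
    & \forall s \near +oo, laplace g s = F s].

Definition euler_gamma (a : R) : R :=
  \int[mu]_(t in `]0, +oo[) (t `^ (a - 1) * expR (- t)).

End Laplace.

Section Problem.
Variables (R : realType) (d : nat).
Local Notation mu := (@lebesgue_measure R).

(* The data of  D_t^alpha U + lin U + nl U = src  on dom x ]0, +oo[  with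
   prescribed (d/dt)^k U(x, 0) = init k x  for k < r. *)
Record fde := FDE {
  alpha : R;
  r : nat;
  dom : set 'rV[R]_d;
  lin : linear_diffop R d;
  nl : nonlinear_diffop R d;
  src : field R d;
  init : nat -> 'rV[R]_d -> R
}.

Variable P : fde.

Definition fde_wf : Prop :=
  [/\ (0 < r P)%N, (r P)%:R - 1 < alpha P <= (r P)%:R & open (dom P)].

Definition evolution_domain : set (spacetime R d) := dom P `*` `]0, +oo[.
Definition closed_domain : set (spacetime R d) :=
  closure (dom P) `*` `[0, +oo[.

Definition caputo (u : field R d) : field R d := fun z =>
  if alpha P == (r P)%:R then partial (nseq (r P) None) u z
  else (euler_gamma ((r P)%:R - alpha P))^-1 *
       \int[mu]_(tau in `[0, z.2])
         ((z.2 - tau) `^ ((r P)%:R - alpha P - 1) *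
          partial (nseq (r P) None) u (z.1, tau)).

(* The equation itself.  It motivates the recursion [qhatm] below, which only
   involves its data; the sum of the series is not required to satisfy it (for
   n <> 1 it need not). *)
Definition fde_equation (u : field R d) : Prop :=
  forall z, evolution_domain z ->
    caputo u z + lin_apply (lin P) u z + nl_apply (nl P) u z = src P z.

(* X is a linear space of continuous functions, bounded on D, to which both
   operators apply.  It is the common domain of the two operators: on all smooth
   functions, boundedness for the maximum norm would force order 0. *)
Definition function_space (D : set (spacetime R d)) (X : set (field R d))
    : Prop :=
  [/\ X (fun=> 0),
      (forall (c : R) u v, X u -> X v -> X (fun z => c * u z + v z))
    & forall u, X u ->
      [/\ {within closed_domain, continuous u},
          [bounded u z | z in D],
          (forall z, evolution_domain z -> lin_defined (lin P) u z)
        & forall z, evolution_domain z -> nl_defined (nl P) u z]].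

Definition lin_bounded (D : set (spacetime R d)) (X : set (field R d)) : Prop :=
  exists sigma : R, forall u, X u -> forall z, D z -> evolution_domain z ->
    `|lin_apply (lin P) u z| <= sigma * maxnorm D u.

Definition nl_lipschitz (D : set (spacetime R d)) (X : set (field R d))
    : Prop :=
  exists kappa : R, forall u v, X u -> X v ->
    forall z, D z -> evolution_domain z ->
    `|nl_apply (nl P) u z - nl_apply (nl P) v z|
      <= kappa * maxnorm D (fun y => u y - v y).

(* sum_{j >= 0} q^j u_j *)
Definition homotopy_sum (u : nat -> field R d) (q : R) : field R d :=
  fun z => limn (series (fun j => q ^+ j * u j z)).

Definition homotopy_nl (u : nat -> field R d) (z : spacetime R d) : R -> R :=
  fun q => nl_apply (nl P) (homotopy_sum u q) z.

(* H_m *)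
Definition homotopy_poly (u : nat -> field R d) (m : nat) : field R d :=
  fun z => (m`!%:R)^-1 * derive1n m (homotopy_nl u z) 0.

(* The expression defining every H_m at z makes sense: for small q the power
   series converges around z, N applies to its sum, and the result is infinitely
   differentiable in q at 0. *)
Definition homotopy_regular (u : nat -> field R d) (z : spacetime R d) : Prop :=
  (\forall q \near (0 : R),
     (\forall y \near z, cvgn (series (fun j => q ^+ j * u j y))) /\
     nl_defined (nl P) (homotopy_sum u q) z) /\
  (forall m, \forall q \near (0 : R), derivable (derive1n m (homotopy_nl u z)) q 1).

Definition k_ (n : R) (m : nat) : R := if (m <= 1)%N then 0 else n.

(* u m is obtained from u (m-1) by the recursion; g and h are the two inverse
   Laplace transforms occurring in it. *)
Definition qhatm_step (hbar n : R) (u : nat -> field R d) (m : nat) : Prop :=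
  forall x, dom P x ->
    let f := fun t => src P (x, t) in
    let b := fun t =>
      lin_apply (lin P) (u m.-1) (x, t) + homotopy_poly u m.-1 (x, t) in
    [/\ laplace_transformable f, laplace_transformable b
      & exists g h : R -> R,
        [/\ inverse_laplace (fun s =>
              (s `^ alpha P)^-1 *
                (\sum_(k < r P) s `^ (alpha P - k%:R - 1) * init P k x) +
              (s `^ alpha P)^-1 * laplace f s) g,
            inverse_laplace (fun s => (s `^ alpha P)^-1 * laplace b s) h
          & forall t, 0 < t ->
              u m (x, t) = (k_ n m + hbar) * u m.-1 (x, t)
                           - hbar * (1 - k_ n m / n) * g t
                           + hbar * h t]].

(* u is the sequence of q-HATM components; u 0 is the initial guess. *)
Definition qhatm (hbar n : R) (u : nat -> field R d) : Prop :=
  (forall z, evolution_domain z -> homotopy_regular u z) /\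
  (forall m, (1 <= m)%N -> qhatm_step hbar n u m).

End Problem.

(* Main.v *)
Require Import Defs.
From HB Require Import structures.
From mathcomp Require Import all_boot all_order all_algebra.
From mathcomp Require Import all_classical all_reals all_analysis.

Import Order.TTheory GRing.Theory Num.Theory.
Import numFieldNormedType.Exports.

Local Open Scope classical_set_scope.
Local Open Scope ring_scope.

(** The hypothesis on consecutive components makes their norms decay at least
    geometrically, [maxnorm D (u m) <= rho ^+ m * maxnorm D (u 0)].  At a fixed
    point of [D] the error left after truncation is the tail of the series
    there, so it is dominated by the tail of a geometric series, whose sum is
    the right-hand side ([geometric_tail_bound]).  The pointwise bound
    does not depend on the point, so it passes to the supremum.

    [maxnorm] is a real supremum, with value [0] on an empty or unbounded set,
    so two facts that are automatic for a norm have to be justified: it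
    dominates pointwise values only for functions bounded on [D], which the
    function space provides ([le_maxnorm]), and it is dominated by a uniform
    bound only if that bound is nonnegative ([maxnorm_le]). *)

Section MaxNorm.
Context {R : realType} {d : nat} (D : set (spacetime R d)).
Implicit Type v : field R d.

Lemma le_maxnorm v z : [bounded v y | y in D] -> D z -> `|v z| <= maxnorm D v.
Proof.
move=> [M [_ vM]] Dz; apply: ub_le_sup; last by exists z.
(* Boundedness gives every bound above [M], not [M] itself. *)
exists (M + 1) => _ [y Dy <-].
by apply: (vM (M + 1)) => //; rewrite ltrDl.
Qed.

Lemma maxnorm_ge0 v : 0 <= maxnorm D v.
Proof.
have [v_sup|/sup_out v_sup] := pselect (has_sup [set `|v z| | z in D]).
  have [[_ [z Dz _]] v_ub] := v_sup.
  by apply: le_trans (normr_ge0 (v z)) (ub_le_sup v_ub _); exists z.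
by rewrite /maxnorm v_sup.
Qed.

(** Nonnegativity of [c] covers an empty [D], where the supremum is [0]. *)
Lemma maxnorm_le v (c : R) :
  0 <= c -> (forall z, D z -> `|v z| <= c) -> maxnorm D v <= c.
Proof.
move=> c_ge0 vc; have [->|/set0P [z Dz]] := eqVneq D set0.
  by rewrite /maxnorm image_set0 sup0.
by apply: ge_sup; [exists `|v z|, z | move=> _ [y Dy <-]; exact: vc].
Qed.

End MaxNorm.

Lemma geometric_decay {R : numDomainType} (a : nat -> R) (rho : R) :
  0 <= rho -> (forall m, a m.+1 <= rho * a m) ->
  forall m, a m <= rho ^+ m * a 0%N.
Proof.
move=> rho_ge0 a_ratio; elim=> [|m IHm]; first by rewrite expr0 mul1r.
by rewrite (le_trans (a_ratio m))// exprS -mulrA ler_wpM2l.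
Qed.

Lemma geometric_block_le {R : numFieldType} (rho : R) (k N : nat) :
  0 <= rho -> rho < 1 -> (k <= N)%N ->
  \sum_(k <= m < N) rho ^+ m <= rho ^+ k / (1 - rho).
Proof.
move=> rho_ge0 rho_lt1 kN; rewrite ler_pdivlMr ?subr_gt0//.
(* Multiplying by [1 - rho] makes the sum telescope. *)
rewrite mulr_suml (eq_bigr (fun m => - (rho ^+ m.+1 - rho ^+ m))); last first.
  by move=> m _; rewrite opprB mulrBr mulr1 exprSr.
by rewrite sumrN telescope_sumr// opprB gerBl exprn_ge0.
Qed.

(** Every partial sum beyond the [k]-th differs from it by at most the sum of a
    geometric block; the bound is uniform in the upper end, so it survives the
    limit. *)
Lemma geometric_tail_bound {R : realType} (a : nat -> R) (l M rho : R)
    (k : nat) :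
  0 <= rho -> rho < 1 -> (forall m, `|a m| <= rho ^+ m * M) ->
  series a @ \oo --> l ->
  `|l - \sum_(0 <= m < k) a m| <= rho ^+ k / (1 - rho) * M.
Proof.
move=> rho_ge0 rho_lt1 aM al.
have M_ge0 : 0 <= M by have := le_trans (normr_ge0 _) (aM 0%N); rewrite mul1r.
have err_cvg : (fun N => `|series a N - \sum_(0 <= m < k) a m|) @ \oo
    --> `|l - \sum_(0 <= m < k) a m|.
  by apply: cvg_norm; apply: cvgB al _; exact: cvg_cst.
apply: (ler_cvg_to err_cvg (cvg_cst _)); near=> N.
have kN : (k <= N)%N by near: N; exact: nbhs_infty_ge.
rewrite /series/= (big_cat_nat (n := k))//= addrAC subrr add0r.
rewrite (le_trans (ler_norm_sum _ _ _))//.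
rewrite (le_trans (ler_sum _ (fun m _ => aM m)))//.
by rewrite -mulr_suml ler_wpM2r// geometric_block_le.
Unshelve. all: by end_near.
Qed.

Theorem theorem3 (R : realType) (d : nat) (P : fde R d) (P_wf : fde_wf P)
    (D : set (spacetime R d)) (D_sub : D `<=` closed_domain P)
    (X : set (field R d)) (X_space : function_space P D X)
    (lin_bdd : lin_bounded P D X) (nl_lip : nl_lipschitz P D X)
    (hbar n : R) (hbar_neq0 : hbar != 0) (n_gt0 : 0 < n)
    (u : nat -> field R d) (u_X : forall m, X (u m))
    (u_qhatm : qhatm P hbar n u)
    (U : field R d)
    (U_sum : forall z, D z -> series (fun m => u m z) @ \oo --> U z)
    (rho : R) (rho_gt0 : 0 < rho) (rho_lt1 : rho < 1)
    (u_ratio : forall m, maxnorm D (u m.+1) <= rho * maxnorm D (u m))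
    (i : nat) :
  maxnorm D (fun z => U z - \sum_(0 <= m < i.+1) u m z)
    <= rho ^+ i.+1 / (1 - rho) * maxnorm D (u 0%N).
Proof.
have norm_decay := geometric_decay (fun m => maxnorm D (u m)) rho
  (ltW rho_gt0) u_ratio.
have [_ _ X_bounded] := X_space.
apply: maxnorm_le => [|z Dz].
  apply: mulr_ge0 (maxnorm_ge0 D _).
  by apply: divr_ge0; rewrite ?subr_ge0 ?exprn_ge0// ltW.
apply: (geometric_tail_bound (u^~ z)) (U_sum z Dz) => // [|m]; first exact: ltW.
apply: le_trans (norm_decay m); apply: le_maxnorm => //.
by have [] := X_bounded _ (u_X m).
Qed.
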